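(* Fix $d\ge 2$, $G=SO(d)$, $f(x)=x$ and $\Omega_i=0$ for all $i$. There is $\alpha^*>0$ (approximately equal to $0.340461$) such that: if $0<\alpha<\alpha^*$, then there is $n^*=n^*(\alpha)$ such that for all $n>n^*$ the graph $\Gamma^{(\alpha,n)}$ supports $1$-twists. Conversely, if $\alpha^*<\alpha\le 1/2$, then there is $n^*=n^*(\alpha)$ such that for all $n>n^*$ the graph $\Gamma^{(\alpha,n)}$ does not support $1$-twists.
   Context: Quantum Kuramoto system on $G=SO(d)$ with $f(x)=x$, $\Omega=0$: for $X=(X_1,\dots,X_n)\in SO(d)^n$, $$X_i'X_i^{-1}=\frac12\sum_{j=1}^n\gamma_{ij}\bigl(X_jX_i^{-1}-X_iX_j^{-1}\bigr),$$ where $\gamma_{ij}=\gamma_{ji}\ge 0$ are the edge weights of an undirected weighted graph on $n$ vertices. A graph is symmetric circulant if $\gamma_{ij}$ depends only on the cyclic distance $k=\min(|i-j|,n-|i-j|)$; one writes $\gamma_k$ for this value, $1\le k\le \lfloor n/2\rfloor$. For $\alpha\in(0,1)$ and each $n$, $\Gamma^{(\alpha,n)}$ is the symmetric circulant graph on $n$ vertices with $\gamma_k=1$ for $k<\lfloor\alpha n\rfloor$ and $\gamma_k=0$ otherwise. Let $T\in SO(d)$ be an element which in some orthonormal basis of $\mathbb R^d$ is the rotation by angle $2\pi/n$ in the plane of the first two basis vectors and the identity on the remaining ones. The configuration $Y_i=T^i$, $i=1,\dots,n$, is called a $1$-twist; it is a fixed point of the system. The linearization at a fixed point $Y$ (in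 coordinates $X_i=Y_i\exp(Q_i)$, $Q_i\in\mathfrak{so}(d)$) is $Q'=\mathcal L_YQ$ with $$(\mathcal L_YQ)_i=\frac12\sum_{j=1}^n\gamma_{ij}\bigl(Y_i^{-1}Y_j(Q_j-Q_i)+(Q_j-Q_i)Y_j^{-1}Y_i\bigr),\qquad Q\in\mathfrak{so}(d)^n.$$ For a twist solution all eigenvalues of $\mathcal L_Y$ are real. The graph supports $1$-twists if the $1$-twist is stable, meaning that no eigenvalue of $\mathcal L_Y$ is positive. *)

(* Defs.v *)
From HB Require Import structures.
From mathcomp Require Import all_boot all_order all_algebra.
From mathcomp Require Import reals trigo.

Set Implicit Arguments.
Unset Strict Implicit.
Unset Printing Implicit Defensive.

Import Order.TTheory GRing.Theory Num.Theory.
Local Open Scope ring_scope.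

Section Defs.
Variable R : realType.

Definition cyclic_dist (n : nat) (i j : 'I_n) : nat :=
  minn `|i - j|%N (n - `|i - j|)%N.

(* [w k] is the weight of the edges joining vertices at cyclic distance k,
   for 1 <= k <= n./2; there are no loops, so [w 0] is not used. *)
Definition circulant_graph (n : nat) (w : nat -> R) : 'M[R]_n :=
  \matrix_(i, j) if i == j then 0 else w (cyclic_dist i j).

Definition Gamma (alpha : R) (n : nat) : 'M[R]_n :=
  circulant_graph n
    (fun k => if k%:Z < Num.floor (alpha * n%:R) then 1 else 0).

Section Dim.
Variable d : nat.

Definition orthogonal_mx (A : 'M[R]_d) : Prop := A *m A^T = 1%:M.

Definition SO (A : 'M[R]_d) : Prop := orthogonal_mx A /\ \det A = 1.

Definition so (A : 'M[R]_d) : Prop := A^T = - A.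

Definition rot12 (t : R) : 'M[R]_d :=
  \matrix_(i, j)
    match val i, val j with
    | 0%N, 0%N => cos t
    | 0%N, 1%N => - sin t
    | 1%N, 0%N => sin t
    | 1%N, 1%N => cos t
    | _, _ => (i == j)%:R
    end.

(* The columns of P are the orthonormal basis in which T is the rotation by
   2 pi / n in the plane of the first two basis vectors. *)
Definition one_twist_generator (n : nat) (T : 'M[R]_d) : Prop :=
  SO T /\
  exists P : 'M[R]_d,
    orthogonal_mx P /\ T = P *m rot12 (2 * pi / n%:R) *m P^T.

(* Ordinals start at 0, hence vertex i carries T ^ (i + 1). *)
Definition twist (n : nat) (T : 'M[R]_d) : 'I_n -> 'M[R]_d :=
  fun i => T ^+ i.+1.

Definition linearization (n : nat) (gamma : 'M[R]_n) (Y : 'I_n -> 'M[R]_d)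
    (Q : {ffun 'I_n -> 'M[R]_d}) : {ffun 'I_n -> 'M[R]_d} :=
  [ffun i => 2^-1 *: \sum_(j < n) gamma i j *:
     (invmx (Y i) *m Y j *m (Q j - Q i) + (Q j - Q i) *m invmx (Y j) *m Y i)].

(* Real eigenvalues of the linearization, as an operator on so(d)^n. *)
Definition lin_eigenvalue (n : nat) (gamma : 'M[R]_n) (Y : 'I_n -> 'M[R]_d)
    (lambda : R) : Prop :=
  exists Q : {ffun 'I_n -> 'M[R]_d},
    [/\ forall i, so (Q i), Q != 0 & linearization gamma Y Q = lambda *: Q].

(* At a twist all the eigenvalues are real, so real ones are enough here. *)
Definition stable (n : nat) (gamma : 'M[R]_n) (Y : 'I_n -> 'M[R]_d) : Prop :=
  forall lambda : R, lin_eigenvalue gamma Y lambda -> ~~ (0 < lambda).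

(* By [supports_one_twistsE] below, the choice of T does not matter. *)
Definition supports_one_twists (n : nat) (gamma : 'M[R]_n) : Prop :=
  forall T : 'M[R]_d, one_twist_generator n T -> stable gamma (twist T).

Lemma SO_inv (A : 'M[R]_d) : SO A -> invmx A = A^T.
Proof.
case=> AAT _; have [Au _] := mulmx1_unit AAT.
by rewrite -[RHS]mul1mx -(mulVmx Au) -mulmxA AAT mulmx1.
Qed.

Lemma SO_exp (A : 'M[R]_d) (k : nat) : SO A -> SO (A ^+ k).
Proof.
move=> [AAT dA]; elim: k => [|k [IH dk]].
  by rewrite expr0; split; rewrite /orthogonal_mx ?trmx1 ?mulmx1 ?det1.
rewrite exprS -mulmxE; split; rewrite /orthogonal_mx.
  by rewrite trmx_mul mulmxA -(mulmxA A) IH mulmx1.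
by rewrite det_mulmx dA dk mulr1.
Qed.

Lemma linearization_so (n : nat) (gamma : 'M[R]_n) (Y : 'I_n -> 'M[R]_d)
    (Q : {ffun 'I_n -> 'M[R]_d}) :
  (forall i, SO (Y i)) -> (forall i, so (Q i)) ->
  forall i, so (linearization gamma Y Q i).
Proof.
move=> YSO Qso i; rewrite /so ffunE linearZ /= -scalerN; congr (_ *: _).
rewrite linear_sum -sumrN; apply: eq_bigr => j _ /=.
rewrite linearZ /= -scalerN; congr (_ *: _).
rewrite !SO_inv // linearD /= !trmx_mul !trmxK linearB /= !Qso -opprD.
rewrite !(mulNmx, mulmxN) opprD addrC.
by rewrite -!mulmxA.
Qed.

End Dim.

Lemma rot12D (d : nat) (s t : R) : (1 < d)%N -> rot12 d (s + t) = rot12 d s *m rot12 d t.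
Proof.
case: d => [|[|k]] // _; apply/matrixP => i j.
rewrite !mxE !big_ord_recl /= !mxE /= cosD sinD.
have tailE (f : 'I_k -> R) (g : 'I_k -> R) :
  (forall m, f m = 0) \/ (forall m, g m = 0) -> \sum_(m < k) f m * g m = 0.
  by case=> f0; apply: big1 => m _; rewrite f0 ?mul0r ?mulr0.
case: (unliftP ord0 i) => [i'|] -> /=; last first.
  rewrite tailE ?addr0; last by left=> m; rewrite !mxE.
  case: (unliftP ord0 j) => [j'|] -> //=; last by rewrite mulNr.
  case: (unliftP ord0 j') => [j''|] -> //=; first by rewrite !mulr0 addr0.
  by rewrite mulrN mulNr -opprD addrC.
case: (unliftP ord0 i') => [i''|] -> /=; last first.
  rewrite tailE ?addr0; last by left=> m; rewrite !mxE.
  case: (unliftP ord0 j) => [j'|] -> //=.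
  case: (unliftP ord0 j') => [j''|] -> //=; first by rewrite !mulr0 addr0.
  by rewrite mulrN addrC.
rewrite !mul0r !add0r (bigD1 i'') //= big1 => [|m mi]; last first.
  by rewrite !mxE /= (inj_eq lift_inj) (inj_eq lift_inj) eq_sym (negPf mi) mul0r.
by rewrite !mxE /= eqxx mul1r addr0.
Qed.

Lemma SO_rot12 (d : nat) (t : R) : (1 < d)%N -> SO (rot12 d t).
Proof.
move=> d_gt1.
have rotT u : (rot12 d u)^T = rot12 d (- u).
  apply/matrixP => i j; rewrite !mxE /= cosN sinN opprK eq_sym.
  by case: i j => [[|[|i]] ?] [[|[|j]] ?].
have rot0 : rot12 d 0 = 1%:M.
  apply/matrixP => i j; rewrite !mxE /= cos0 sin0 oppr0.
  by case: i j => [[|[|i]] ?] [[|[|j]] ?].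
have rotO u : orthogonal_mx (rot12 d u).
  by rewrite /orthogonal_mx rotT -rot12D // subrr rot0.
split=> //.
rewrite [t]splitr rot12D // det_mulmx -[X in _ * X]det_tr -det_mulmx.
by rewrite rotO det1.
Qed.

(* Hence the quantifier in [supports_one_twists] is not vacuous. *)
Lemma one_twist_generator_rot12 (d n : nat) :
  (1 < d)%N -> one_twist_generator n (rot12 d (2 * pi / n%:R)).
Proof.
move=> d_gt1; split; first exact: SO_rot12.
by exists 1%:M; rewrite /orthogonal_mx !trmx1 mulmx1 mul1mx mulmx1.
Qed.

Lemma stable_conj (d n : nat) (gamma : 'M[R]_n) (U S T : 'M[R]_d) :
  orthogonal_mx U -> SO S -> SO T -> T = U *m S *m U^T ->
  stable gamma (twist S) -> stable gamma (twist T).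
Proof.
move=> UU SS TS TE st lambda [Q [Qso Q0 QE]]; apply: st.
have UtU : U^T *m U = 1%:M by apply: mulmx1C.
have powE k : T ^+ k = U *m S ^+ k *m U^T.
  elim: k => [|k IH]; first by rewrite !expr0 mulmx1 UU.
  by rewrite !exprS -!mulmxE IH {1}TE !mulmxA -(mulmxA (U *m S)) UtU mulmx1.
have powVE k : invmx (T ^+ k) = U *m invmx (S ^+ k) *m U^T.
  by rewrite (SO_inv (SO_exp k TS)) (SO_inv (SO_exp k SS)) powE !trmx_mul trmxK mulmxA.
have cK A : U *m (U^T *m A *m U) *m U^T = A.
  by rewrite !mulmxA UU mul1mx -mulmxA UU mulmx1.
exists [ffun i => U^T *m Q i *m U]; split.
- by move=> i; rewrite /so ffunE !trmx_mul trmxK Qso mulNmx mulmxN mulmxA.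
- apply: contra_neq Q0 => Q0; apply/ffunP => i; move/ffunP: Q0 => /(_ i).
  by rewrite !ffunE -{2}[Q i]cK => ->; rewrite mulmx0 mul0mx.
apply/ffunP => i; rewrite !ffunE.
have -> : lambda *: (U^T *m Q i *m U) = U^T *m (lambda *: Q) i *m U.
  by rewrite ffunE -scalemxAr -scalemxAl.
rewrite -QE ffunE -scalemxAr -scalemxAl; congr (_ *: _).
rewrite mulmx_sumr mulmx_suml; apply: eq_bigr => j _.
rewrite -scalemxAr -scalemxAl; congr (_ *: _); rewrite !ffunE /twist.
have -> : U^T *m Q j *m U - U^T *m Q i *m U = U^T *m (Q j - Q i) *m U.
  by rewrite mulmxBr mulmxBl.
move: (Q j - Q i) => D; rewrite !powVE !powE mulmxDr mulmxDl !mulmxA.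
have UtUl (p : nat) (A : 'M[R]_(p, d)) : A *m U^T *m U = A.
  by rewrite -mulmxA UtU mulmx1.
by rewrite UtU mul1mx !UtUl.
Qed.

Lemma supports_one_twistsE (d n : nat) (gamma : 'M[R]_n) (T : 'M[R]_d) :
  one_twist_generator n T ->
  supports_one_twists d gamma <-> stable gamma (twist T).
Proof.
move=> gT; split=> [|st S [SS [P [PP SE]]]]; first exact.
case: gT => TS [P' [PP' TE]].
have P'K : P'^T *m P' = 1%:M by apply: mulmx1C.
apply: (stable_conj (U := P *m P'^T)) SS _ st => //.
  rewrite /orthogonal_mx trmx_mul trmxK !mulmxA -(mulmxA P) P'K mulmx1.
  exact: PP.
rewrite SE TE trmx_mul trmxK !mulmxA.
by rewrite -!(mulmxA _ P'^T P') P'K !mulmx1.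
Qed.

End Defs.

(* Main.v *)
Require Import Defs.
From mathcomp Require Import all_boot all_order all_algebra.
From mathcomp Require Import reals trigo.
From mathcomp Require Import classical_sets topology normedtype derive realfun.
From mathcomp Require Import ring lra zify complex.

Set Implicit Arguments.
Unset Strict Implicit.
Unset Printing Implicit Defensive.

Import Order.TTheory GRing.Theory Num.Theory.
Import numFieldNormedType.Exports.
Local Open Scope ring_scope.

(** For the standard generator the linearization splits along the
decomposition of so(d) into the rotation plane (entry 01), the d - 2 mixed
planes (entries 0q and 1q, which the twist rotates as one complex number) and
so(d - 2) (entries pq).  Each piece is a circulant operator on the vertices,
diagonalized by the discrete Fourier transform.  Let C m be the sum of
cos (2 pi m k / n) over the nonzero offsets k that carry an edge.  For the
Fourier mode m the eigenvalues are
- (C (m+1) + C (m-1)) / 2 - C 1 on the rotation plane,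
- (C m + C (m+1) - C 0 - C 1) / 2 on each mixed plane,
- C m - C 0 on so(d - 2).

Clearly C m <= C 0.  The decisive inequality is C m <= C 1 for 0 < m < n
([band_transform_le1]), which needs that edges reach at most half-way around
the cycle, that is, alpha <= 1/2.  As 1 + C m is the Dirichlet kernel
sin (N m y) / sin (m y), with y = pi / n and N neighbours (the vertex itself
included), it says that
|sin (m a)| sin b <= sin (m b) sin a for b <= a <= pi - b and m b <= pi / 2
([sin_mul_le], by induction on m).  Hence every eigenvalue is nonpositive, for
every n, except possibly that of mode 1 (or n - 1) on the rotation plane, which
is (C 0 + C 2) / 2 - C 1.  It is attained, so the twist is stable if and only
if C 0 + C 2 <= 2 C 1 ([band_supportsE]).

Multiplied by sin y cos y, the number C 0 + C 2 - 2 C 1 is within 16 y of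
h (2 pi alpha), where h x = x + sin x cos x - 2 sin x ([critical_mode_gap]);
so for large n the sign of h (2 pi alpha) decides.  Since
h' = 2 cos (cos - 1), the function h decreases from h 0 = 0 on [0, pi/2] and
increases on [pi/2, pi]; its only zero in (0, pi] is 2 pi alphastar.  It is
located with Taylor bounds on sine and cosine, which also provide the decimals
of pi. *)

(** * Taylor bounds for sine and cosine *)

Section Taylor.
Variable R : realType.
Implicit Types (f df : R -> R) (a b x : R).

Lemma derive_mvt f df a b : (forall x, is_derive x 1 f (df x)) -> a < b ->
  exists2 c, a < c < b & f b - f a = df c * (b - a).
Proof.
move=> fdf ab.
have fc : {within `[a, b], continuous f}%classic.
  apply: continuous_subspaceT => x.
  by apply/differentiable_continuous/derivable1_diffP; have [] := fdf x.
have [c cab ->] := MVT ab (fun x _ => fdf x) fc.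
by exists c => //; move: cab; rewrite in_itv.
Qed.

Lemma derive_gt0_lt f df a b : (forall x, is_derive x 1 f (df x)) -> a < b ->
  (forall x, a < x < b -> 0 < df x) -> f a < f b.
Proof.
move=> fdf ab df0; have [c cab fE] := derive_mvt fdf ab.
by rewrite -subr_gt0 fE mulr_gt0 ?df0 ?subr_gt0.
Qed.

Lemma derive_ge0_le f df a b : (forall x, is_derive x 1 f (df x)) -> a <= b ->
  (forall x, a <= x -> 0 <= df x) -> f a <= f b.
Proof.
move=> fdf; rewrite le_eqVlt => /predU1P[->//|ab] df0.
have [c /andP[ac _] fE] := derive_mvt fdf ab.
by rewrite -subr_ge0 fE mulr_ge0 ?df0 ?subr_ge0 // ltW.
Qed.

Lemma derive_lipschitz f df (k : R) a b : (forall x, is_derive x 1 f (df x)) ->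
  (forall x, `|df x| <= k) -> `|f b - f a| <= k * `|b - a|.
Proof.
move=> fdf dfk; wlog ab : a b / a < b => [wl|].
  case: (ltgtP a b) => [|ba|->]; first exact: wl.
    by rewrite distrC (distrC b); apply: wl.
  by rewrite !subrr normr0 mulr0.
have [c _ ->] := derive_mvt fdf ab.
by rewrite normrM ler_wpM2r.
Qed.

(** The n first terms of the alternating series x^d/d! - x^(d+2)/(d+2)! + ...:
the cosine series for d = 0 and the sine series for d = 1.  Unfolding it from
its first term makes d vary, so that differentiating just lowers d. *)
Fixpoint taylor d n x : R :=
  if n is m.+1 then x ^+ d / d`!%:R - taylor d.+2 m x else 0.

(** Pointwise forms of the rules for sums, multiples and differences, so that
they unify with functions written as abstractions. *)
Lemma is_derive_add f g x (a b : R) : is_derive x 1 f a -> is_derive x 1 g b ->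
  is_derive x 1 (fun y => f y + g y) (a + b).
Proof. exact: is_deriveD. Qed.

Lemma is_derive_scale f x c (a : R) : is_derive x 1 f a ->
  is_derive x 1 (fun y => c * f y) (c * a).
Proof. exact: is_deriveZ. Qed.

Lemma is_derive_sub f g x (a b : R) : is_derive x 1 f a -> is_derive x 1 g b ->
  is_derive x 1 (fun y => f y - g y) (a - b).
Proof. exact: is_deriveB. Qed.

Lemma is_derive_monomial n x :
  is_derive x 1 (fun y : R => y ^+ n.+1 / n.+1`!%:R) (x ^+ n / n`!%:R).
Proof.
rewrite (_ : (fun y => _) = fun y : R => n.+1`!%:R^-1 * y ^+ n.+1); last first.
  by apply/boolp.funext => y; rewrite mulrC.
have dXn : is_derive x 1 (fun y : R => y ^+ n.+1) (n.+1%:R * x ^+ n).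
  rewrite (_ : (fun y => _) = horner 'X^(n.+1)); last first.
    by apply/boolp.funext => y; rewrite hornerXn.
  apply: is_derive_eq (is_derive_poly _ _) _.
  by rewrite derivXn hornerMn hornerXn mulr_natl.
apply: is_derive_eq (is_derive_scale _ dXn) _.
rewrite factS natrM invfM.
have : n`!%:R != 0 :> R by rewrite pnatr_eq0 -lt0n fact_gt0.
have : n.+1%:R != 0 :> R by rewrite pnatr_eq0.
move: (n.+1%:R : R) (n`!%:R : R) => k l k0 l0.
by field; rewrite k0 l0.
Qed.

Lemma is_derive_taylorS d n x : is_derive x 1 (taylor d.+1 n) (taylor d n x).
Proof.
elim: n d => [|n IH] d /=; first exact: is_derive_cst.
exact: is_derive_sub (is_derive_monomial _ _) (IH _).
Qed.

Lemma is_derive_taylor0 n x : is_derive x 1 (taylor 0 n.+1) (- taylor 1 n x).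
Proof.
rewrite -sub0r; apply: is_derive_sub (is_derive_taylorS _ _ _).
rewrite (_ : (fun y : R => _) = fun=> 1); first exact: is_derive_cst.
by apply/boolp.funext => y; rewrite fact0 expr0 invr1 mul1r.
Qed.

Lemma taylorS_at0 d n : taylor d.+1 n 0 = 0.
Proof. by elim: n d => //= n IH d; rewrite IH exprS !mul0r subrr. Qed.

Lemma taylor0_at0 n : taylor 0 n.+1 0 = 1.
Proof. by rewrite /= taylorS_at0 fact0 expr0 invr1 mul1r subr0. Qed.

(** The error of each truncation is an antiderivative, vanishing at 0, of the
error of the previous one (up to sign), so that the signs propagate from
cos x <= 1 through all orders. *)
Lemma taylor_bounds n x : 0 <= x ->
  0 <= (-1) ^+ n.+1 * (cos x - taylor 0 n.+1 x) /\
  0 <= (-1) ^+ n.+1 * (sin x - taylor 1 n.+1 x).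
Proof.
have sinS m : (forall x, 0 <= x -> 0 <= (-1) ^+ m * (cos x - taylor 0 m x)) ->
    forall x, 0 <= x -> 0 <= (-1) ^+ m * (sin x - taylor 1 m x).
  move=> H {}x x0.
  pose f y := (-1) ^+ m * (sin y - taylor 1 m y).
  have <- : f 0 = 0 by rewrite /f sin0 taylorS_at0 subrr mulr0.
  apply: (@derive_ge0_le f _ 0 x _ x0 H) => y.
  exact: is_derive_scale (is_derive_sub _ (is_derive_taylorS 0 m y)).
have cosS m : (forall x, 0 <= x -> 0 <= (-1) ^+ m * (sin x - taylor 1 m x)) ->
    forall x, 0 <= x -> 0 <= (-1) ^+ m.+1 * (cos x - taylor 0 m.+1 x).
  move=> H {}x x0.
  pose f y := (-1) ^+ m.+1 * (cos y - taylor 0 m.+1 y).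
  have <- : f 0 = 0 by rewrite /f cos0 taylor0_at0 subrr mulr0.
  apply: (@derive_ge0_le f _ 0 x _ x0 H) => y.
  apply: (is_derive_eq (is_derive_scale _
    (is_derive_sub (is_derive_cos y) (is_derive_taylor0 m y)))).
  by rewrite exprS mulN1r -opprD mulrNN.
have cos1 y : 0 <= y -> 0 <= (-1) ^+ 1 * (cos y - taylor 0 1 y).
  move=> _; rewrite /= fact0 expr0 subr0 !mul1r invr1 mulN1r opprB subr_ge0.
  exact: cos_le1.
elim: n x => [|n IH] x x0; first by split; [exact: cos1|exact: sinS cos1 _ x0].
have cosn y (y0 : 0 <= y) : 0 <= (-1) ^+ n.+2 * (cos y - taylor 0 n.+2 y).
  by apply: cosS y0 => z z0; case: (IH z z0).
by split; [exact: cosn|exact: sinS cosn _ x0].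
Qed.

Lemma taylor_le n x : 0 <= x ->
  taylor 0 n.*2.+2 x <= cos x /\ taylor 1 n.*2.+2 x <= sin x.
Proof.
move=> /(taylor_bounds n.*2.+1)[].
by rewrite -signr_odd !oddS odd_double expr0 !mul1r !subr_ge0.
Qed.

Lemma taylor_ge n x : 0 <= x ->
  cos x <= taylor 0 n.*2.+1 x /\ sin x <= taylor 1 n.*2.+1 x.
Proof.
move=> /(taylor_bounds n.*2)[].
by rewrite -signr_odd oddS odd_double expr1 !mulN1r !opprB !subr_ge0.
Qed.

(** Horner form of [taylor] without factorials: it keeps the numerals small when
the bounds are evaluated at a rational point. *)
Fixpoint alt_horner d n (y : R) : R :=
  if n is m.+1 then 1 - y / (d.+1%:R * d.+2%:R) * alt_horner d.+2 m y else 1.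

Lemma taylor_horner d n x :
  taylor d n.+1 x = x ^+ d / d`!%:R * alt_horner d n (x ^+ 2).
Proof.
elim: n d => [|n IH] d; first by rewrite /= mulr1 subr0.
rewrite [LHS]/= -/(taylor d.+2 n.+1 x) IH [alt_horner d _ _]/=.
rewrite mulrBr mulr1 !mulrA; congr (_ - _ * _).
rewrite !factS !natrM !exprS.
by field; rewrite -(natrD _ 2) -(natrD _ 1) !pnatr_eq0 /= -lt0n fact_gt0.
Qed.

End Taylor.

(** * The limit function of the critical eigenvalue *)

Section TwistGap.
Variable R : realType.
Implicit Types (a b x y : R).

(** Eight or nine terms leave an error below 10^-8 for x <= 2.14, while the
estimates below need about 10^-7. *)
Lemma cos_ge x : 0 <= x -> alt_horner 0 7 (x ^+ 2) <= cos x.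
Proof. by move=> /(taylor_le 3)[+ _]; rewrite taylor_horner fact0 expr0 invr1 !mul1r. Qed.

Lemma cos_le x : 0 <= x -> cos x <= alt_horner 0 8 (x ^+ 2).
Proof. by move=> /(taylor_ge 4)[+ _]; rewrite taylor_horner fact0 expr0 invr1 !mul1r. Qed.

Lemma sin_ge x : 0 <= x -> x * alt_horner 1 7 (x ^+ 2) <= sin x.
Proof. by move=> /(taylor_le 3)[_]; rewrite taylor_horner invr1 mulr1. Qed.

Lemma sin_le x : 0 <= x -> sin x <= x * alt_horner 1 8 (x ^+ 2).
Proof. by move=> /(taylor_ge 4)[_]; rewrite taylor_horner invr1 mulr1. Qed.

Lemma cos_anti a b : 0 <= a -> a <= b -> b <= pi -> cos b <= cos a.
Proof.
move=> a0 ab bpi.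
have [b0 api] := (le_trans a0 ab, le_trans ab bpi).
by rewrite leNgt ltr_cos -?leNgt // in_itv /= ?a0 ?b0.
Qed.

(** The sign of the cosine at p / 2 tells on which side of p the number pi lies. *)
Lemma pi_gt : 3 + 1415 / 10 ^+ 4 + 926 / 10 ^+ 7 < pi :> R.
Proof.
set p := (X in X < _); have pE : p = 3 + 1415 / 10 ^+ 4 + 926 / 10 ^+ 7 by [].
have c0 : 0 < cos (p / 2) by apply: lt_le_trans (cos_ge _) => /=; rewrite pE; lra.
rewrite ltNge; apply/negP => pip.
suff : cos (p / 2) <= cos (pi / 2) by rewrite cos_pihalf leNgt c0.
have p2 := @pi_ge2 R.
by apply: cos_anti; rewrite pE in pip *; lra.
Qed.

Lemma pi_lt : pi < 3 + 1415 / 10 ^+ 4 + 927 / 10 ^+ 7 :> R.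
Proof.
set p := (X in _ < X); have pE : p = 3 + 1415 / 10 ^+ 4 + 927 / 10 ^+ 7 by [].
have c0 : cos (p / 2) < 0 by apply: le_lt_trans (cos_le _) _ => /=; rewrite pE; lra.
rewrite ltNge; apply/negP => pip.
suff : cos (pi / 2) <= cos (p / 2) by rewrite cos_pihalf leNgt c0.
have p2 := @pi_ge2 R.
by apply: cos_anti; rewrite pE in pip *; lra.
Qed.

(** With x = 2 pi alpha, this is twice the integral over [0, x] of
cos t (cos t - 1): the limit of C 0 + C 2 - 2 C 1 divided by n / pi. *)
Definition twist_gap x : R := x + sin x * cos x - 2 * sin x.

Lemma is_derive_twist_gap x :
  is_derive x 1 twist_gap (2 * cos x * (cos x - 1)).
Proof.
have dsc : is_derive x 1 (fun y : R => sin y * cos y) (cos x ^+ 2 - sin x ^+ 2).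
  apply: (is_derive_eq (is_deriveM (is_derive_sin x) (is_derive_cos x))).
  rewrite /GRing.scale /=; ring.
apply: is_derive_eq (is_derive_sub (is_derive_add (is_derive_id x 1) dsc)
  (is_derive_scale 2 (is_derive_sin x))) _.
by rewrite sin2cos2; ring.
Qed.

Lemma twist_gap0 : twist_gap 0 = 0.
Proof. by rewrite /twist_gap sin0; ring. Qed.

Lemma cos_lt1 x : 0 < x -> x <= pi -> cos x < 1.
Proof.
by move=> x0 xpi; rewrite -cos0 ltr_cos // in_itv /= ?lexx ?pi_ge0 // (ltW x0).
Qed.

Lemma twist_gap_lt0_pihalf x : 0 < x -> x <= pi / 2 -> twist_gap x < 0.
Proof.
move=> x0 xpi; have p2 := @pi_ge2 R.
have dN y := is_derive_scale (-1) (is_derive_twist_gap y).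
have := derive_gt0_lt dN x0; rewrite twist_gap0 mulr0 !mulN1r oppr_gt0; apply.
move=> y /andP[y0 yx]; rewrite mulN1r oppr_gt0 pmulr_rlt0.
  by rewrite subr_lt0 cos_lt1 //; lra.
by rewrite mulr_gt0 // cos_gt0_pihalf //; apply/andP; split; lra.
Qed.

Lemma twist_gap_incr a b : pi / 2 <= a -> a < b -> b <= pi -> twist_gap a < twist_gap b.
Proof.
move=> api ab bpi; have p2 := @pi_ge2 R.
apply: derive_gt0_lt is_derive_twist_gap ab _ => y /andP[ay yb].
rewrite nmulr_rgt0; first by rewrite subr_lt0 cos_lt1 //; lra.
rewrite pmulr_rlt0 // -cos_pihalf ltr_cos ?in_itv /=; try by apply/andP; split; lra.
lra.
Qed.

Lemma twist_gap_lipschitz a b : `|twist_gap b - twist_gap a| <= 4 * `|b - a|.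
Proof.
apply: derive_lipschitz is_derive_twist_gap _ => x.
have := cos_le1 x; have := cos_geN1 x => h1 h2.
rewrite ler_norml; apply/andP; split; nra.
Qed.

(** This point is slightly above 2 pi * 0.3404605. *)
Lemma twist_gap_neg : twist_gap (2 + 1391 / 10 ^+ 4 + 765 / 10 ^+ 7) < 0.
Proof.
set u := (X in twist_gap X); have u0 : 0 <= u by rewrite /u; lra.
have s : 8427 / 10 ^+ 4 + 739 / 10 ^+ 7 <= sin u.
  by apply: le_trans (sin_ge u0) => /=; rewrite /u; clear; lra.
have c : cos u <= - (5382 / 10 ^+ 4 + 675 / 10 ^+ 7).
  by apply: le_trans (cos_le u0) _ => /=; rewrite /u; clear; lra.
have c2 : 0 <= 2 - cos u by rewrite subr_ge0 (le_trans (cos_le1 u)) ?ler1n.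
have uE : u = 2 + 1391 / 10 ^+ 4 + 765 / 10 ^+ 7 by [].
rewrite /twist_gap; clearbody u; move: (sin u) (cos u) s c c2 => S C s c c2.
have sS : 0 <= S - (8427 / 10 ^+ 4 + 739 / 10 ^+ 7) by rewrite subr_ge0.
(* u + S C - 2 S = u - S (2 - C), where both factors are bounded below. *)
have := mulr_ge0 sS c2.
rewrite uE; clear uE u0; lra.
Qed.

(** This point is slightly below 2 pi * 0.3404615.  The true zero is so close
that the gap here is only 7 * 10^-7, whence the eight decimals. *)
Lemma twist_gap_pos : 0 < twist_gap (2 + 1391 / 10 ^+ 4 + 826 / 10 ^+ 7).
Proof.
set u := (X in twist_gap X); have u0 : 0 <= u by rewrite /u; lra.
have s : sin u <= 8427 / 10 ^+ 4 + 7072 / 10 ^+ 8.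
  by apply: le_trans (sin_le u0) _ => /=; rewrite /u; clear; lra.
have c : - (5382 / 10 ^+ 4 + 7277 / 10 ^+ 8) <= cos u.
  by apply: le_trans (cos_ge u0) => /=; rewrite /u; clear; lra.
have c2 : 0 <= 2 - cos u by rewrite subr_ge0 (le_trans (cos_le1 u)) ?ler1n.
have uE : u = 2 + 1391 / 10 ^+ 4 + 826 / 10 ^+ 7 by [].
rewrite /twist_gap; clearbody u; move: (sin u) (cos u) s c c2 => S C s c c2.
have sS : 0 <= 8427 / 10 ^+ 4 + 7072 / 10 ^+ 8 - S by rewrite subr_ge0.
have := mulr_ge0 sS c2.
rewrite uE; clear uE u0; lra.
Qed.

Lemma twist_gap_lower : twist_gap (2 * pi * (3404 / 10 ^+ 4 + 605 / 10 ^+ 7)) < 0.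
Proof.
have [pl pu] := (pi_gt, pi_lt).
by apply: lt_trans (twist_gap_incr _ _ _) twist_gap_neg; lra.
Qed.

Lemma twist_gap_upper : 0 < twist_gap (2 * pi * (3404 / 10 ^+ 4 + 615 / 10 ^+ 7)).
Proof.
have [pl pu] := (pi_gt, pi_lt).
by apply: lt_trans twist_gap_pos (twist_gap_incr _ _ _); lra.
Qed.

Lemma critical_alpha : exists a : R,
  [/\ 3404 / 10 ^+ 4 + 605 / 10 ^+ 7 < a, a < 3404 / 10 ^+ 4 + 615 / 10 ^+ 7
    & twist_gap (2 * pi * a) = 0].
Proof.
set l : R := 3404 / 10 ^+ 4 + 605 / 10 ^+ 7; set u : R := 3404 / 10 ^+ 4 + 615 / 10 ^+ 7.
have pi2 : 0 < 2 * pi :> R by rewrite mulr_gt0 ?pi_gt0.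
have lu : 2 * pi * l <= 2 * pi * u by rewrite ler_pM2l // /l /u; lra.
have [fl fu] := (twist_gap_lower, twist_gap_upper); rewrite -/l -/u in fl fu.
have fc : {within `[2 * pi * l, 2 * pi * u], continuous twist_gap}%classic.
  apply: continuous_subspaceT => x.
  apply/differentiable_continuous/derivable1_diffP.
  by have [] := is_derive_twist_gap x.
have sgn : Num.min (twist_gap (2 * pi * l)) (twist_gap (2 * pi * u)) <= 0
    <= Num.max (twist_gap (2 * pi * l)) (twist_gap (2 * pi * u)).
  by rewrite ge_min le_max (ltW fl) (ltW fu) orbT.
have [c + fc0] := IVT lu fc sgn; rewrite in_itv /= => /andP[lc cu].
exists (c / (2 * pi)); rewrite [2 * pi * _]mulrC divfK ?gt_eqF //; split=> //.
  rewrite ltr_pdivlMr // mulrC lt_neqAle lc andbT.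
  by apply: contraTneq fl => ->; rewrite fc0 ltxx.
rewrite ltr_pdivrMr // mulrC lt_neqAle cu andbT.
by apply: contraTneq fu => <-; rewrite fc0 ltxx.
Qed.

End TwistGap.

(** * The Fourier transform of a band *)

Section Band.
Variable R : realType.
Implicit Types (a b x y : R) (n K k m : nat).

(** At b = pi / n this compares the Dirichlet kernel at the m-th and first Fourier
modes.  The induction writes sin ((m+1) a) by the addition formula; with
sin beta = |sin (m a)| sin b / sin a, the claim for m is beta <= m b, and
|cos (m a)| <= cos beta because sin b <= sin a.  So the left-hand side for m + 1
is at most sin (beta + b) sin a. *)
Lemma sin_mul_le a b m : 0 < b -> b <= a -> a <= pi - b -> m%:R * b <= pi / 2 ->
  `|sin (m%:R * a)| * sin b <= sin (m%:R * b) * sin a.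
Proof.
move=> b0 ba abpi; have p0 := @pi_gt0 R.
have sb0 : 0 < sin b by apply: sin_gt0_pi; apply/andP; split; lra.
have sa0 : 0 < sin a by apply: sin_gt0_pi; apply/andP; split; lra.
have cb0 : 0 <= cos b by apply: cos_ge0_pihalf; apply/andP; split; lra.
have cab : `|cos a| <= cos b.
  have cpa : cos (pi - a) = - cos a by rewrite cosB cospi sinpi mulN1r mul0r addr0.
  by rewrite ler_norml lerNl -cpa; apply/andP; split; apply: cos_anti; lra.
have sba : sin b <= sin a.
  rewrite -(ler_pXn2r (n := 2)) ?nnegrE ?(ltW sb0) ?(ltW sa0) // !sin2cos2 lerD2l lerN2.
  by rewrite -[cos a ^+ 2]real_normK ?num_real // ler_pXn2r ?nnegrE.
elim: m => [_|m IH mb]; first by rewrite !mul0r sin0 normr0 !mul0r.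
have mb' : m%:R * b <= pi / 2 - b.
  by move: mb; rewrite -natr1 mulrDl mul1r; lra.
have mb0 : 0 <= m%:R * b by rewrite mulr_ge0 // ltW.
have {}IH : `|sin (m%:R * a)| * sin b <= sin (m%:R * b) * sin a by apply: IH; lra.
pose r := `|sin (m%:R * a)| * sin b / sin a.
have rE : r * sin a = `|sin (m%:R * a)| * sin b by rewrite divfK ?gt_eqF.
have r0 : 0 <= r by rewrite divr_ge0 ?mulr_ge0 // ltW.
have rs : r <= sin (m%:R * b) by rewrite ler_pdivrMr.
have r11 : -1 <= r <= 1 by rewrite (le_trans rs (sin_le1 _)) andbT; lra.
pose beta := asin r.
have sbeta : sin beta = r by rewrite asinK // in_itv.
have [bl bu] := (asin_geNpi2 r11, asin_lepi2 r11).
rewrite -/beta in bl bu.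
have beta_le : beta <= m%:R * b.
  rewrite leNgt; apply/negP => mbb.
  suff : sin (m%:R * b) < sin beta by rewrite sbeta ltNge rs.
  by rewrite ltr_sin // in_itv /=; apply/andP; split; lra.
have cbeta : `|cos (m%:R * a)| <= cos beta.
  have cb1 : 0 <= cos beta by apply: cos_ge0_pihalf; rewrite bl.
  rewrite -(ler_pXn2r (n := 2)) ?nnegrE // real_normK ?num_real // !cos2sin2 sbeta.
  rewrite lerD2l lerN2 -[leRHS]real_normK ?num_real // ler_pXn2r ?nnegrE //.
  by rewrite ler_pdivrMr // ler_wpM2l.
have step : sin (beta + b) <= sin (m.+1%:R * b).
  rewrite -natr1 mulrDl mul1r leNgt ltr_sin -?leNgt ?lerD2r //;
    by rewrite in_itv /=; apply/andP; split; lra.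
apply: le_trans (ler_wpM2r (ltW sa0) step).
rewrite -natr1 mulrDl mul1r !sinD sbeta.
apply: (@le_trans _ _
    ((`|sin (m%:R * a)| * `|cos a| + `|cos (m%:R * a)| * sin a) * sin b)).
  rewrite ler_wpM2r ?(ltW sb0) // (le_trans (ler_normD _ _)) // !normrM.
  by rewrite (ger0_norm (ltW sa0)).
rewrite !mulrDl lerD //.
  by rewrite mulrAC -rE mulrAC ler_wpM2r ?(ltW sa0) // ler_wpM2l.
by rewrite mulrAC ler_wpM2r ?(ltW sa0) // ler_wpM2r ?(ltW sb0).
Qed.

(** Weight of the offset k in Z/n: an edge joins the vertices at cyclic distance
less than K.  For 2 K <= n the two indicators, one for each orientation, never
overlap. *)
Definition band n K k : R := (0 < k < K)%N%:R + (n - K < k < n)%N%:R.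

Lemma band_sym n K k : (0 < k < n)%N -> (K <= n)%N -> band n K (n - k) = band n K k.
Proof.
move=> /andP[k0 kn] Kn; rewrite /band addrC; congr (_%:R + _%:R); lia.
Qed.

(** The two halves of the band are exchanged by k -> n - k. *)
Lemma sum_band n K (F : nat -> R) : (0 < K <= n)%N ->
  (forall k, (k <= n)%N -> F (n - k)%N = F k) ->
  \sum_(k < n) band n K k * F k = 2 * \sum_(1 <= k < K) F k.
Proof.
move=> /andP[K0 Kn] Fsym.
rewrite -(big_mkord xpredT (fun k => band n K k * F k)).
have n0 : (0 < n)%N by apply: leq_trans Kn.
rewrite big_ltn // {1}/band ltnn ltn0 /= addr0 mul0r add0r.
rewrite (eq_bigr (fun k =>
    (0 < k < K)%N%:R * F k + (n - K < k < n)%N%:R * F k)); last first.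
  by move=> k _; rewrite mulrDl.
rewrite big_split /=.
have S1 : \sum_(1 <= k < n) (0 < k < K)%N%:R * F k = \sum_(1 <= k < K) F k.
  rewrite (big_cat_nat K0 Kn) /= [X in _ + X]big_nat_cond [X in _ + X]big1 ?addr0.
    by apply: eq_big_nat => k ->; rewrite mul1r.
  by move=> k; rewrite andbT => /andP[Kk _]; rewrite [(k < K)%N]ltnNge Kk andbF mul0r.
rewrite S1 [X in _ + X = _]big_nat_rev /= mulr_natl mulr2n; congr (_ + _); rewrite -{}S1.
apply: eq_big_nat => k /andP[k0 kn].
have -> : (n - K < 1 + n - k.+1 < n)%N = (0 < k < K)%N by lia.
by rewrite add1n subSS Fsym // ltnW.
Qed.

Definition cos_transform n (w : nat -> R) m : R :=
  \sum_(k < n) w k * cos (m%:R * (k%:R * (2 * pi / n%:R))).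

Definition band_transform n K := cos_transform n (band n K).

Lemma dirichlet_kernel K x : (0 < K)%N ->
  sin x * (1 + 2 * \sum_(1 <= k < K) cos (k%:R * (2 * x))) = sin ((2 * K%:R - 1) * x).
Proof.
elim: K => // -[_ _|K IH _].
  by rewrite big_geq // mulr0 addr0 mulr1; congr sin; ring.
rewrite big_nat_recr //=; have := IH isT.
move: (\sum_(_ <= _ < _) _) => S; set u := K.+1%:R * (2 * x) => SE.
have -> : sin x * (1 + 2 * (S + cos u)) = sin x * (1 + 2 * S) + 2 * sin x * cos u.
  by ring.
rewrite SE.
have -> : (2 * K.+1%:R - 1) * x = u - x by rewrite /u; ring.
have -> : (2 * K.+2%:R - 1) * x = u + x by rewrite /u -(natr1 K.+1); ring.
by rewrite sinB sinD; ring.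
Qed.

Section Transform.
Variables n K : nat.
Hypothesis Kn : (0 < K <= n)%N.
Local Notation t := (2 * pi / n%:R : R).
Local Notation C := (band_transform n K).

Let n0 : n%:R != 0 :> R.
Proof. by rewrite pnatr_eq0 -lt0n; case/andP: Kn; apply: leq_trans. Qed.

Lemma cosB2pi m x : cos (m%:R * (2 * pi) - x) = cos x.
Proof.
rewrite -cosN opprB (_ : m%:R * (2 * pi) = pi *+ 2 *+ m); last by rewrite !mulr_natl.
by rewrite -[in RHS](subrK (pi *+ 2 *+ m) x) (periodicn (@cosD2pi R)).
Qed.

Lemma band_transform_sym m : (m <= n)%N -> C (n - m) = C m.
Proof.
move=> mn; apply: eq_bigr => k _; congr (_ * _).
rewrite natrB // -(cosB2pi k (m%:R * _)); congr cos.
by field.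
Qed.

Lemma band_transformE m :
  (1 + C m) * sin (m%:R * (pi / n%:R)) = sin ((2 * K%:R - 1) * (m%:R * (pi / n%:R))).
Proof.
have [K0 _] := andP Kn.
rewrite -dirichlet_kernel // mulrC; congr (_ * (1 + _)).
rewrite /band_transform /cos_transform
  (sum_band (F := fun k => cos (m%:R * (k%:R * t)))) //.
  by congr (_ * _); apply: eq_bigr => k _; congr cos; ring.
move=> k kn; rewrite natrB // -(cosB2pi m (m%:R * _)); congr cos.
by field.
Qed.

Lemma band_transform0 : 1 + C 0 = 2 * K%:R - 1.
Proof.
have [K0 _] := andP Kn.
rewrite /band_transform /cos_transform
  (sum_band (F := fun k => cos (0%:R * (k%:R * t)))) //; last first.
  by move=> k kn; rewrite !mul0r.
under eq_bigr do rewrite mul0r cos0.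
rewrite sumr_const_nat natrB //; ring.
Qed.

Lemma band_transform_le0 m : C m <= C 0.
Proof.
apply: ler_sum => k _; rewrite ler_wpM2l ?addr_ge0 ?ler0n //.
by rewrite mul0r cos0 cos_le1.
Qed.

(** The symmetry m -> n - m reduces to m <= n / 2, where [sin_mul_le] applies with
a = (2 K - 1) pi / n and b = pi / n; the hypothesis 2 K <= n is a <= pi - b. *)
Lemma band_transform_le1 m : (2 * K <= n)%N -> (0 < m < n)%N -> C m <= C 1.
Proof.
move=> K2n; wlog m2 : m / (2 * m <= n)%N => [wl /andP[m0 mn]|/andP[m0 mn]].
  case: (leqP (2 * m) n) => m2n; first by apply: wl => //; rewrite m0.
  by rewrite -band_transform_sym 1?ltnW //; apply: wl; lia.
have p0 := @pi_gt0 R.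
have n1 : 0 < n%:R :> R by rewrite ltr0n; lia.
have [K0 _] := andP Kn.
pose y : R := pi / n%:R.
have y0 : 0 < y by rewrite divr_gt0.
have ny : n%:R * y = pi by rewrite mulrC divfK.
have K1R : 1 <= K%:R :> R by rewrite ler1n.
have K2R : 2 * K%:R <= n%:R :> R by rewrite -natrM ler_nat.
have m2R : 2 * m%:R <= n%:R :> R by rewrite -natrM ler_nat.
have m1R : 1 <= m%:R :> R by rewrite ler1n.
have my : m%:R * y <= pi / 2 by nra.
have sy : 0 < sin y by apply: sin_gt0_pi; apply/andP; split; nra.
have smy : 0 < sin (m%:R * y) by apply: sin_gt0_pi; apply/andP; split; nra.
rewrite -(lerD2l 1) -(ler_pM2r smy) -(ler_pM2r sy).
have E1 := band_transformE 1; rewrite mul1r -/y in E1.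
rewrite band_transformE -/y [leRHS]mulrAC E1 mulrCA.
apply: le_trans (ler_wpM2r (ltW sy) (ler_norm _)) _.
by rewrite [leRHS]mulrC; apply: sin_mul_le => //; nra.
Qed.
End Transform.

Lemma small_angle_bounds y : 0 <= y -> y <= 1 ->
  [/\ y - 2 / 3 * y ^+ 3 <= sin y * cos y, sin y <= y & 1 - y ^+ 2 / 2 <= cos y].
Proof.
move=> y0 y1.
have [c s] := taylor_le 0 y0; have [_ s'] := taylor_ge 0 y0.
rewrite /= in c s s'.
have {}c : 1 - y ^+ 2 / 2 <= cos y by move: c; rewrite !factS fact0 !natrM; lra.
have {}s : y - y ^+ 3 / 6 <= sin y by move: s; rewrite !factS fact0 !natrM; lra.
have {}s' : sin y <= y by move: s'; rewrite !factS fact0; lra.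
split=> //.
have y2 : 0 <= y ^+ 2 <= 1 by rewrite sqr_ge0 expr_le1.
have [y2_ge0 y2_le1] := andP y2.
have y5 : 0 <= y ^+ 5 by rewrite exprn_ge0.
have s0 : 0 <= y - y ^+ 3 / 6.
  have -> : y - y ^+ 3 / 6 = y * (1 - y ^+ 2 / 6) by ring.
  by rewrite mulr_ge0 //; lra.
have c0 : 0 <= 1 - y ^+ 2 / 2 by lra.
apply: le_trans (ler_pM s0 c0 s c); rewrite -subr_ge0.
rewrite [leRHS](_ : _ = y ^+ 5 / 12); last by field.
by rewrite divr_ge0.
Qed.

(** Put psi = (2 K - 1) y.  The Dirichlet formula turns the left-hand number into
(2 K - 1) sin y cos y + sin psi cos psi - 2 sin psi cos y.  Replacing sin y by y
and cos y by 1 gives the gap at psi with an error at most 4 y, and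
|psi - 2 pi alpha| <= 3 y costs 12 y more. *)
Lemma critical_mode_gap alpha n K y : (3 < n)%N -> (0 < K)%N -> alpha <= 1 / 2 ->
  alpha * n%:R - 1 < K%:R -> K%:R <= alpha * n%:R ->
  y = pi / n%:R ->
  `|(band_transform n K 0 + band_transform n K 2 - 2 * band_transform n K 1)
      * (sin y * cos y) - twist_gap (2 * pi * alpha)| <= 16 * y.
Proof.
move=> n3 K0 a2 Kl Ku yE.
have n3R : 4 <= n%:R :> R by rewrite ler_nat.
have K0R : 1 <= K%:R :> R by rewrite ler1n.
have K2R : 2 * K%:R <= n%:R :> R by nra.
have K2 : (2 * K <= n)%N by move: K2R; rewrite -natrM ler_nat.
have Kn : (0 < K <= n)%N by lia.
have p2 := @pi_ge2 R; have p0 := @pi_gt0 R.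
have p4 : pi <= 4 :> R by have := @pihalf_lt2 R; lra.
have y0 : 0 < y by rewrite yE divr_gt0 //; lra.
have ny : n%:R * y = pi by rewrite yE mulrC divfK //; apply/eqP; lra.
have y1 : y <= 1 by nra.
pose psi := (2 * K%:R - 1) * y.
have E0 := band_transform0 Kn.
have E1 := band_transformE Kn 1; rewrite mul1r -yE -/psi in E1.
have E2 := band_transformE Kn 2; rewrite -yE in E2.
have [syc sy cy] := small_angle_bounds (ltW y0) y1.
have sy0 : 0 <= sin y by apply: sin_ge0_pi; apply/andP; split; lra.
have cy1 := cos_le1 y.
have s2y : sin (2 * y) = 2 * (sin y * cos y).
  by rewrite mulr_natl sin_mulr2n -mulr_natl (mulrC (cos y)).
have s2psi : sin ((2 * K%:R - 1) * (2 * y)) = 2 * (sin psi * cos psi).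
  by rewrite mulrCA -/psi [2 * psi]mulr_natl sin_mulr2n -mulr_natl (mulrC (cos _)).
rewrite {}s2y {}s2psi in E2.
set Z := (X in `|X - _|).
have ZE : Z = (2 * K%:R - 1) * (sin y * cos y) + sin psi * cos psi - 2 * sin psi * cos y.
  have {}E2 : (1 + band_transform n K 2) * (sin y * cos y) = sin psi * cos psi by lra.
  by rewrite -E0 -E2 -E1 /Z; ring.
have psi_le : 0 <= psi <= 4 by rewrite /psi; apply/andP; split; nra.
have [psi0 psi4] := andP psi_le.
have discr : `|Z - twist_gap psi| <= 4 * y.
  have -> : Z - twist_gap psi =
      ((2 * K%:R - 1) * (sin y * cos y) - psi) + 2 * sin psi * (1 - cos y).
    by rewrite ZE /twist_gap; ring.
  have N1 : 1 <= 2 * K%:R - 1 :> R by lra.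
  have up : (2 * K%:R - 1) * (sin y * cos y) <= psi.
    by rewrite ler_wpM2l //; [lra | rewrite (le_trans _ sy) // ler_piMr].
  have lo : psi - 2 / 3 * psi * y ^+ 2 <= (2 * K%:R - 1) * (sin y * cos y).
    rewrite (_ : _ - _ = (2 * K%:R - 1) * (y - 2 / 3 * y ^+ 3)); last first.
      by rewrite /psi; ring.
    by rewrite ler_wpM2l //; lra.
  have y2 : 0 <= y ^+ 2 <= y by rewrite sqr_ge0 expr2 ler_piMr ?(ltW y0).
  have [y20 y21] := andP y2.
  have py2 : psi * y ^+ 2 <= 4 * y by rewrite ler_pM.
  have sc : `|2 * sin psi * (1 - cos y)| <= y.
    rewrite !normrM ger0_norm // (ger0_norm (_ : 0 <= 1 - cos y)) ?subr_ge0 //.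
    apply: (@le_trans _ _ (2 * 1 * (y ^+ 2 / 2))); last by lra.
    by rewrite ler_pM ?mulr_ge0 ?ler_wpM2l ?sin_max //; lra.
  apply: le_trans (ler_normD _ _) _.
  have : `|(2 * K%:R - 1) * (sin y * cos y) - psi| <= 3 * y.
    by rewrite ler_norml; apply/andP; split; lra.
  by lra.
have cont : `|twist_gap psi - twist_gap (2 * pi * alpha)| <= 12 * y.
  apply: le_trans (twist_gap_lipschitz _ _) _.
  have -> : psi - 2 * pi * alpha = (2 * (K%:R - alpha * n%:R) - 1) * y.
    by rewrite /psi -ny; ring.
  rewrite normrM (ger0_norm (ltW y0)) mulrA ler_wpM2r ?(ltW y0) //.
  have : `|2 * (K%:R - alpha * n%:R) - 1| <= 3.
    by rewrite ler_norml; apply/andP; split; lra.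
  by lra.
rewrite (_ : Z - _ = (Z - twist_gap psi) +
    (twist_gap psi - twist_gap (2 * pi * alpha))); last by ring.
by apply: le_trans (ler_normD _ _) _; lra.
Qed.
End Band.

(** * Eigenvalues of circulant operators *)

Section Fourier.
Variables (F : fieldType) (n : nat) (om : F).
Hypotheses (om_prim : n.+1.-primitive_root om) (n0 : n.+1%:R != 0 :> F).

(** The m-th character of Z/(n+1). *)
Let chi m (i : 'I_n.+1) : F := (om ^+ i) ^+ m.

Let chiD m i j : chi m (i + j) = chi m i * chi m j.
Proof. by rewrite /chi /= (prim_expr_mod om_prim) exprD exprMn. Qed.

Let chi0 m : chi m 0 = 1.
Proof. by rewrite /chi expr0 expr1n. Qed.

Let sum_chi i : \sum_(m < n.+1) chi m i = if i == 0 then n.+1%:R else 0.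
Proof.
case: eqVneq => [->|i0].
  by under eq_bigr do rewrite chi0; rewrite sumr_const card_ord.
apply/eqP; have : (om ^+ i - 1) * \sum_(m < n.+1) chi m i == 0.
  by rewrite -subrX1 exprAC (prim_expr_order om_prim) expr1n subrr.
rewrite mulf_eq0 => /orP[|//]; rewrite subr_eq0 -(expr0 om) (eq_prim_root_expr om_prim).
by rewrite mod0n modn_small // => /eqP i0'; case/eqP: i0; apply: val_inj.
Qed.

(** The discrete Fourier transform diagonalizes the operator, and a nonzero vector
has some nonzero Fourier coefficient.  The weights lie in the field itself, to
cover the complex ones of the mixed planes. *)
Lemma circulant_eigenvalue (w z : 'I_n.+1 -> F) (lambda : F) :
  (exists i, z i != 0) ->
  (forall i, lambda * z i = \sum_k w k * (z (i + k) - z i)) ->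
  exists m : 'I_n.+1, lambda = \sum_k w k * ((om ^+ k) ^+ m - 1).
Proof.
move=> [i zi] eigen.
pose Z m := \sum_j chi m (- j) * z j.
have [m Zm] : exists m : 'I_n.+1, Z m != 0.
  apply/existsP; apply: contraNT zi => /existsPn Z0.
  have : \sum_(m < n.+1) chi m i * Z m = 0.
    by apply: big1 => m _; have := Z0 m; rewrite negbK => /eqP ->; rewrite mulr0.
  under eq_bigr do rewrite mulr_sumr.
  rewrite exchange_big /= (bigD1 i) //= [X in _ + X]big1 ?addr0 => [|j ji].
    under eq_bigr do rewrite mulrA -chiD subrr chi0 mul1r.
    rewrite sumr_const card_ord -mulr_natl => /eqP.
    by rewrite mulf_eq0 (negPf n0).
  under eq_bigr do rewrite mulrA -chiD.
  by rewrite -mulr_suml sum_chi subr_eq0 eq_sym (negPf ji) mul0r.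
exists m; apply: (mulIf Zm); rewrite mulr_suml.
transitivity (\sum_j chi m (- j) * (lambda * z j)).
  by rewrite mulr_sumr; apply: eq_bigr => j _; rewrite mulrCA.
under eq_bigr do rewrite eigen mulr_sumr.
rewrite exchange_big /=; apply: eq_bigr => k _.
under eq_bigr do rewrite mulrCA.
rewrite -mulr_sumr -mulrA; congr (_ * _).
under eq_bigr do rewrite mulrBr.
rewrite sumrB mulrBl mul1r; congr (_ - _).
rewrite (reindex_inj (addIr (- k))) mulr_sumr; apply: eq_bigr => j _ /=.
by rewrite subrK opprB addrC chiD -mulrA mulrCA -/(chi m k) !mulrA (mulrC (chi m k)).
Qed.
End Fourier.

Section UnitRoot.
Variables (R : realType) (n : nat).
Implicit Types (i j k : 'I_n.+1).
Local Notation t := (2 * pi / n.+1%:R : R).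

(** Angles 2 pi k / (n+1) may be computed with k in Z or in Z/(n+1). *)
Lemma periodic_modn (U : Type) (f : R -> U) (a : nat) :
  (forall x, f (x + 2 * pi) = f x) -> f ((a %% n.+1)%N%:R * t) = f (a%:R * t).
Proof.
move=> fper; have fpern q x : f (x + q%:R * (2 * pi)) = f x.
  by elim: q => [|q IH]; rewrite ?mul0r ?addr0 // -natr1 mulrDl mul1r addrA fper.
rewrite {2}(divn_eq a n.+1) natrD natrM -(fpern (a %/ n.+1)%N); congr f.
by field; rewrite addrC natr1 pnatr_eq0.
Qed.

Lemma cos_add2pi (x : R) : cos (x + 2 * pi) = cos x.
Proof. by rewrite mulr_natl cosD2pi. Qed.

Lemma sin_add2pi (x : R) : sin (x + 2 * pi) = sin x.
Proof. by rewrite mulr_natl sinD2pi. Qed.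

Lemma muln_angle : n.+1%:R * t = 2 * pi.
Proof. by field; rewrite addrC natr1 pnatr_eq0. Qed.

Lemma periodic_sub (U : Type) (f : R -> U) i j :
  (forall x, f (x + 2 * pi) = f x) ->
  f ((j - i)%R%:R * t) = f ((j%:R - i%:R) * t).
Proof.
move=> fper; rewrite /= modnDmr periodic_modn // -(fper ((_ - _) * t)); congr f.
by rewrite natrD natrB ?(ltnW (ltn_ord i)) // -[X in _ = _ + X]muln_angle; ring.
Qed.

Definition unit_root : R[i] := (cos t +i* sin t)%C.

Lemma unit_rootX (k : nat) : unit_root ^+ k = (cos (k%:R * t) +i* sin (k%:R * t))%C.
Proof.
elim: k => [|k IH]; first by rewrite expr0 mul0r cos0 sin0.
rewrite exprSr IH -(natr1 k) (mulrDl _ _ t) mul1r cosD sinD.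
by apply/eqP; rewrite eq_complex /= eqxx /= addrC eqxx.
Qed.

Lemma unit_root_prim : n.+1.-primitive_root unit_root.
Proof.
rewrite /primitive_root_of_unity /=; apply/forallP => i.
rewrite unity_rootE unit_rootX; apply/eqP; case: (eqVneq i.+1 n.+1) => [->|ni].
  by rewrite muln_angle mulr_natl cos2pi sin2pi eqxx.
apply/negbTE/negP; rewrite eq_complex /= => /andP[/eqP c1 _].
have p0 := @pi_gt0 R.
have n0 : 0 < n.+1%:R :> R by rewrite ltr0n.
have i1 : i.+1%:R < n.+1%:R :> R by rewrite ltr_nat ltn_neqAle ni ltn_ord.
have i0 : 0 < i.+1%:R :> R by rewrite ltr0n.
pose x : R := i.+1%:R / n.+1%:R * pi.
have x0 : 0 < sin x.
  apply: sin_gt0_pi; rewrite !mulr_gt0 ?invr_gt0 //=.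
  by rewrite gtr_pMl // ltr_pdivrMr // mul1r.
move: c1; rewrite (_ : _ * t = x *+ 2); last by rewrite /x -[RHS]mulr_natl; ring.
rewrite cos_mulr2n cos2sin2 => c1.
have : sin x ^+ 2 = 0 by lra.
by move/eqP; rewrite sqrf_eq0 (gt_eqF x0).
Qed.

(** Since lambda is real, only the real parts of the Fourier symbol matter, and
these are plain cosine sums. *)
Lemma real_circulant_eigenvalue (w z : 'I_n.+1 -> R[i]) (lambda : R) :
  (exists i, z i != 0) ->
  (forall i, lambda%:C%C * z i = \sum_k w k * (z (i + k) - z i)) ->
  exists m : 'I_n.+1, lambda = \sum_k complex.Re (w k * ((unit_root ^+ k) ^+ m - 1)).
Proof.
move=> z0 eigen.
have nC : n.+1%:R != 0 :> R[i] by rewrite pnatr_eq0.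
have [m E] := circulant_eigenvalue unit_root_prim nC z0 eigen.
exists m; have -> : lambda = complex.Re lambda%:C%C by [].
by rewrite E (raddf_sum (@complex.Re R : {additive Rcomplex R -> R})).
Qed.
End UnitRoot.

(** * The linearization at the standard twist *)

Section Blocks.
Variables (R : realType) (d n : nat).
Implicit Types (i j k : 'I_n.+1) (p q : 'I_d.+2) (a : R).
Local Notation t := (2 * pi / n.+1%:R : R).
Local Notation rot := (@rot12 R d.+2).
Local Notation o0 := (ord0 : 'I_d.+2).
Local Notation o1 := (lift ord0 ord0 : 'I_d.+2).

Lemma rot12_mul0 a (A : 'M[R]_d.+2) q :
  (rot a *m A) o0 q = cos a * A o0 q - sin a * A o1 q.
Proof.
rewrite mxE !big_ord_recl /= !mxE /= big1 ?addr0 ?mulNr // => r _.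
by rewrite !mxE /= mul0r.
Qed.

Lemma rot12_mul1 a (A : 'M[R]_d.+2) q :
  (rot a *m A) o1 q = sin a * A o0 q + cos a * A o1 q.
Proof.
rewrite mxE !big_ord_recl /= !mxE /= big1 ?addr0 // => r _.
by rewrite !mxE /= mul0r.
Qed.

Lemma rot12_mul_ge2 a (A : 'M[R]_d.+2) p q : (1 < p)%N -> (rot a *m A) p q = A p q.
Proof.
move=> p1; have rotE r : rot a p r = (p == r)%:R.
  by rewrite mxE; case: p p1 => [[|[|s]] sp].
rewrite mxE (bigD1 p) //= big1 => [|r rp]; rewrite rotE.
  by rewrite eqxx mul1r addr0.
by rewrite eq_sym (negPf rp) mul0r.
Qed.

Lemma rot12_trmx a : (rot a)^T = rot (- a).
Proof.
apply/matrixP => p q; rewrite !mxE /= cosN sinN opprK eq_sym.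
by case: p q => [[|[|p]] ?] [[|[|q]] ?].
Qed.

Lemma rot12X a (m : nat) : rot a ^+ m = rot (m%:R * a).
Proof.
elim: m => [|m IH]; last first.
  by rewrite exprS IH -mulmxE -rot12D // -natr1 mulrDl mul1r addrC.
rewrite expr0 mul0r; apply/matrixP => p q; rewrite !mxE cos0 sin0 oppr0.
by case: p q => [[|[|p]] ?] [[|[|q]] ?].
Qed.

Lemma rot12_add2pi a : rot (a + 2 * pi) = rot a.
Proof. by apply/matrixP => p q; rewrite !mxE cos_add2pi sin_add2pi. Qed.

Lemma twist_rot12 i : twist (rot t) i = rot (i.+1%:R * t).
Proof. exact: rot12X. Qed.

Lemma twist_ratio i j :
  invmx (twist (rot t) i) *m twist (rot t) j = rot ((j%:R - i%:R) * t).
Proof.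
rewrite !twist_rot12 SO_inv; last exact: SO_rot12.
rewrite rot12_trmx -rot12D // -(natr1 i) -(natr1 j).
by congr rot; ring.
Qed.

(** The entries of (M A + A M^T) / 2 for the rotation M and an antisymmetric A:
then A M^T = - (M A)^T. *)
Definition antisym_act a (A : 'M[R]_d.+2) p q : R :=
  2^-1 * ((rot a *m A) p q - (rot a *m A) q p).

Lemma linearization_twistE (w : nat -> R) (gamma : 'M[R]_n.+1)
    (Q : {ffun 'I_n.+1 -> 'M[R]_d.+2}) i p q :
  (forall i j, gamma i j = w (j - i)%R) -> (forall i, so (Q i)) ->
  linearization gamma (twist (rot t)) Q i p q =
  \sum_(k < n.+1) w k * antisym_act (k%:R * t) (Q (i + k) - Q i) p q.
Proof.
move=> gammaE Qso; rewrite ffunE mxE summxE mulr_sumr (reindex_inj (addrI i)).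
apply: eq_bigr => k _; rewrite mxE gammaE addrAC subrr add0r mulrCA; congr (_ * _).
rewrite /antisym_act; congr (_ * _).
set A := Q (i + k) - Q i.
have Aso : A^T = - A by rewrite /A linearB /= !Qso opprB opprK addrC.
rewrite -(mulmxA A) !twist_ratio.
have -> : rot ((i%:R - (i + k)%R%:R) * t) = (rot (((i + k)%R%:R - i%:R) * t))^T.
  by rewrite rot12_trmx -mulNr opprB.
rewrite -(periodic_sub _ _ rot12_add2pi) (addrAC i) subrr add0r.
move: (rot _) => M; rewrite mxE; congr (_ + _).
by rewrite -[A *m _]trmxK trmx_mul trmxK Aso mulmxN !mxE.
Qed.
End Blocks.

Section Spectrum.
Variables (R : realType) (d n : nat).
Implicit Types (i j k : 'I_n.+1) (p q : 'I_d.+2) (a : R).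
Local Notation t := (2 * pi / n.+1%:R : R).
Local Notation rot := (@rot12 R d.+2).
Local Notation o0 := (ord0 : 'I_d.+2).
Local Notation o1 := (lift ord0 ord0 : 'I_d.+2).
Variables (w : nat -> R) (gamma : 'M[R]_n.+1).
Hypothesis gammaE : forall i j, gamma i j = w (j - i)%R.

Local Notation C := (cos_transform n.+1 w).

Section Antisym.
Variables (a : R) (A : 'M[R]_d.+2).
Hypothesis Aso : so A.

Let AC p q : A p q = - A q p.
Proof. by have /matrixP/(_ q p) := Aso; rewrite !mxE. Qed.

Let A0 p : A p p = 0.
Proof. by have := AC p p; lra. Qed.

Lemma antisym_act01 : antisym_act a A o0 o1 = cos a * A o0 o1.
Proof. by rewrite /antisym_act rot12_mul0 rot12_mul1 !A0 (AC o1 o0); lra. Qed.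

Lemma antisym_act0_ge2 q : (1 < q)%N ->
  antisym_act a A o0 q = 2^-1 * ((1 + cos a) * A o0 q - sin a * A o1 q).
Proof.
by move=> q1; rewrite /antisym_act rot12_mul0 rot12_mul_ge2 // (AC q o0); ring.
Qed.

Lemma antisym_act1_ge2 q : (1 < q)%N ->
  antisym_act a A o1 q = 2^-1 * (sin a * A o0 q + (1 + cos a) * A o1 q).
Proof.
by move=> q1; rewrite /antisym_act rot12_mul1 rot12_mul_ge2 // (AC q o1); ring.
Qed.

Lemma antisym_act_ge2 p q : (1 < p)%N -> (1 < q)%N -> antisym_act a A p q = A p q.
Proof.
by move=> p1 q1; rewrite /antisym_act !rot12_mul_ge2 // (AC q p); lra.
Qed.
End Antisym.

Lemma ReZ a (z : R[i]) : complex.Re (a%:C%C * z) = a * complex.Re z.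
Proof. by case: z => x y /=; rewrite mul0r subr0. Qed.

Lemma complex_sum (f g : 'I_n.+1 -> R) :
  \sum_k (f k +i* g k)%C = ((\sum_k f k) +i* (\sum_k g k))%C.
Proof.
apply/eqP; rewrite eq_complex (raddf_sum (@complex.Re R : {additive Rcomplex R -> R})).
by rewrite (raddf_sum (@complex.Im R : {additive Rcomplex R -> R})) /= !eqxx.
Qed.

(** A nonzero eigenvector has a nonzero entry p < q.  The entry 01, the pair of
entries 0q and 1q read as one complex number, or the entry pq alone then
satisfies a scalar circulant equation, with weights w k cos (k t),
w k (1 + exp (i k t)) / 2 and w k respectively. *)
Lemma twist_eigenvalue lambda :
  lin_eigenvalue gamma (twist (rot t)) lambda ->
  exists m : 'I_n.+1,
    [\/ lambda = \sum_(k < n.+1) w k * (cos (k%:R * t) * (cos (m%:R * (k%:R * t)) - 1)),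
        lambda = 2^-1 * (C m + C m.+1 - C 0 - C 1) | lambda = C m - C 0].
Proof.
case=> Q [Qso Q0 QE].
have QC i p q : Q i p q = - Q i q p.
  by have /matrixP/(_ q p) := Qso i; rewrite !mxE.
have [i [p [q [pq Qpq]]]] : exists i p q, (p < q)%N /\ Q i p q != 0.
  case: (boolP [exists i, [exists p, [exists q, Q i p q != 0]]]); last first.
    move=> noQ; case/eqP: Q0; apply/ffunP => i; rewrite ffunE; apply/matrixP => p q.
    rewrite mxE; apply/eqP; apply: contraNT noQ => Qn0.
    by apply/existsP; exists i; apply/existsP; exists p; apply/existsP; exists q.
  move=> /existsP[i /existsP[p /existsP[q Qn0]]]; exists i.
  case: (ltngtP p q) => [pq|qp|/val_inj pq]; first by exists p, q.
    by exists q, p; rewrite QC oppr_eq0.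
  by move: Qn0; rewrite pq; have := QC i q q => QQ; case/eqP; lra.
have eigen j r s : lambda * Q j r s =
    \sum_(k < n.+1) w k * antisym_act (k%:R * t) (Q (j + k) - Q j) r s.
  by rewrite -(linearization_twistE _ _ _ gammaE Qso) QE ffunE mxE.
have Dso j k : so (Q (j + k) - Q j).
  by rewrite /so linearB /= !Qso opprB opprK addrC.
have rootE (m : nat) k :
    (unit_root R n ^+ k) ^+ m =
    (cos (m%:R * (k%:R * t)) +i* sin (m%:R * (k%:R * t)))%C.
  by rewrite -exprM mulnC unit_rootX natrM -mulrA.
have q0 : (0 < q)%N by apply: leq_ltn_trans pq.
case: (ltnP q 2) => q2.
  have pE : p = o0 by apply: val_inj => /=; lia.
  have qE : q = o1 by apply: val_inj => /=; rewrite /bump /=; lia.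
  have [||m E] := @real_circulant_eigenvalue _ _
      (fun k => (w k * cos (k%:R * t))%:C%C) (fun i => (Q i o0 o1)%:C%C) lambda.
  - by exists i; rewrite -qE -pE; apply: contraNneq Qpq => /complexI ->.
  - move=> j; rewrite -rmorphM eigen rmorph_sum; apply: eq_bigr => k _.
    by rewrite antisym_act01 // !mxE -rmorphB -rmorphM mulrA.
  exists m; apply: Or31; rewrite E; apply: eq_bigr => k _.
  by rewrite ReZ rootE /= -mulrA.
case: (ltnP p 2) => p2; last first.
  have [||m E] := @real_circulant_eigenvalue _ _
      (fun k => (w k)%:C%C) (fun i => (Q i p q)%:C%C) lambda.
  - by exists i; apply: contraNneq Qpq => /complexI ->.
  - move=> j; rewrite -rmorphM eigen rmorph_sum; apply: eq_bigr => k _.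
    by rewrite antisym_act_ge2 // !mxE -rmorphB -rmorphM.
  exists m; apply: Or33; rewrite E -sumrB; apply: eq_bigr => k _.
  by rewrite ReZ rootE /= mul0r cos0 mulrBr.
have [||m E] := @real_circulant_eigenvalue _ _
    (fun k => (w k / 2)%:C%C * (1 + unit_root R n ^+ k))
    (fun i => (Q i o0 q +i* Q i o1 q)%C) lambda.
- exists i; apply: contra Qpq; rewrite eq_complex /= => /andP[E0 E1].
  case: (posnP p) => p0.
    by have -> : p = o0 by apply: val_inj.
  by have -> : p = o1 by apply: val_inj => /=; rewrite /bump /=; lia.
- move=> j.
  have -> : lambda%:C%C * (Q j o0 q +i* Q j o1 q)%C
      = (lambda * Q j o0 q +i* (lambda * Q j o1 q))%C.
    by apply/eqP; rewrite eq_complex /= !mul0r subr0 addr0 !eqxx.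
  rewrite !eigen -complex_sum; apply: eq_bigr => k _.
  rewrite antisym_act0_ge2 // antisym_act1_ge2 // unit_rootX !mxE.
  apply/eqP; rewrite eq_complex /=; apply/andP; by split; apply/eqP; field.
exists m; apply: Or32; rewrite E -big_split -!sumrB mulr_sumr /=; apply: eq_bigr => k _.
rewrite -mulrA ReZ mulrBr mulr1 mulrDl mul1r -exprS !rootE.
rewrite -[unit_root R n ^+ k]expr1 rootE /= mul0r cos0.
by field.
Qed.
End Spectrum.

(** * Stability of the twist on a band *)

Section BandStability.
Variables (R : realType) (d n K : nat).
Implicit Types (i j k : 'I_n.+1) (p q : 'I_d.+2) (a : R).
Local Notation t := (2 * pi / n.+1%:R : R).
Local Notation rot := (@rot12 R d.+2).
Local Notation o0 := (ord0 : 'I_d.+2).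
Local Notation o1 := (lift ord0 ord0 : 'I_d.+2).
Local Notation C := (band_transform R n.+1 K).
Variable gamma : 'M[R]_n.+1.
Hypothesis gammaE : forall i j, gamma i j = band R n.+1 K (j - i)%R.
Hypotheses (K0 : (0 < K)%N) (K2 : (2 * K <= n.+1)%N).

Let Kn : (0 < K <= n.+1)%N. Proof. by lia. Qed.

(** From 2 cos x cos (m x) = cos ((m+1) x) + cos ((m-1) x). *)
Lemma rotation_mode_eigenvalue (m : nat) :
  \sum_(k < n.+1) band R n.+1 K k * (cos (k%:R * t) * (cos (m.+1%:R * (k%:R * t)) - 1))
  = 2^-1 * (C m.+2 + C m) - C 1.
Proof.
rewrite /band_transform /cos_transform [2^-1 * _]mulrDr !mulr_sumr.
rewrite -big_split -sumrB /=; apply: eq_bigr => k _.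
set x := k%:R * t; rewrite mul1r.
have -> : m.+2%:R * x = m.+1%:R * x + x by rewrite -natr1 mulrDl mul1r.
have -> : m%:R * x = m.+1%:R * x - x by rewrite -(natr1 m) mulrDl mul1r addrK.
by rewrite cosB cosD; field.
Qed.

(** The inequalities C m <= C 0 and, off mode 0, C m <= C 1 settle every
eigenvalue except, on the rotation plane, that of the first and last nonzero
modes, where C 0 enters: half of C 0 + C 2 - 2 C 1. *)
Lemma band_stable : C 0 + C 2 <= 2 * C 1 -> stable gamma (twist (rot t)).
Proof.
move=> crit lambda /(twist_eigenvalue gammaE)[m]; rewrite -leNgt.
have le0 := band_transform_le0 R n.+1 K.
have le1 (a : nat) : (0 < a < n.+1)%N -> C a <= C 1 by apply: band_transform_le1.
have sym (a : nat) : (a <= n.+1)%N -> C (n.+1 - a) = C a by apply: band_transform_sym.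
have mn := ltn_ord m.
case=> ->; last by rewrite subr_le0 le0.
  case: (nat_of_ord m) mn => [_|a an].
    by rewrite big1 // => k _; rewrite mul0r cos0 subrr !mulr0.
  rewrite rotation_mode_eigenvalue.
  suff : C a.+2 + C a <= 2 * C 1 by lra.
  case: (posnP a) => [->|a0]; first by rewrite addrC.
  have Ca : C a <= C 1 by apply: le1; lia.
  have [a2|] := ltnP a.+2 n.+1; first by have := le1 a.+2 a2; lra.
  move=> na; have Ea : a = (n.+1 - 2)%N by lia.
  have -> : a.+2 = (n.+1 - 0)%N by lia.
  by rewrite {1}Ea !sym //; lia.
rewrite pmulr_rle0 ?invr_gt0 //.
change (C m + C m.+1 - C 0 - C 1 <= 0).
case: (posnP m) => [->|m0]; first by lra.
have [m1|nm] := ltnP m.+1 n.+1; first by have := le1 m.+1 m1; have := le0 m; lra.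
have E1 : m.+1 = (n.+1 - 0)%N by lia.
have Cm := le1 m; rewrite m0 mn in Cm.
by have := Cm isT; rewrite E1 sym //; lra.
Qed.

(** The vector cos (2 pi i / n) J, with J the generator of the rotation plane, is
an eigenvector for the critical eigenvalue: the sine part of the Fourier sum
drops out because the band is symmetric. *)
Lemma band_unstable : 2 * C 1 < C 0 + C 2 -> ~ stable gamma (twist (rot t)).
Proof.
move=> crit st; pose lambda := 2^-1 * (C 2 + C 0) - C 1.
have l0 : 0 < lambda by rewrite /lambda; lra.
pose J : 'M[R]_d.+2 := delta_mx o0 o1 - delta_mx o1 o0.
have Jso : so J by rewrite /so linearB /= !trmx_delta opprB.
suff /st : lin_eigenvalue gamma (twist (rot t)) lambda by rewrite l0.
pose Q : {ffun 'I_n.+1 -> 'M[R]_d.+2} := [ffun i : 'I_n.+1 => cos (i%:R * t) *: J].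
have Qso i : so (Q i) by rewrite /so ffunE linearZ /= Jso scalerN.
exists Q; split=> //.
  apply/eqP => /ffunP/(_ 0); rewrite !ffunE mul0r cos0 scale1r => /matrixP/(_ o0 o1).
  by rewrite !mxE /= subr0 => /eqP; rewrite oner_eq0.
apply/ffunP => i; apply/matrixP => p q.
rewrite (linearization_twistE _ _ _ gammaE Qso).
have actJ a c : antisym_act a (c *: J) p q = cos a * (c * J p q).
  have ordP r :
      [\/ r = o0, r = o1 | [/\ (1 < r)%N, (r == o0) = false & (r == o1) = false]].
    case: r => [[|[|r]] rd]; [apply: Or31|apply: Or32|apply: Or33]; last by split.
      exact: val_inj.
    exact: val_inj.
  rewrite /antisym_act.
  by case: (ordP p) => [->|->|[p1 p0 p01]]; case: (ordP q) => [->|->|[q1 q0 q01]];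
    rewrite ?rot12_mul0 ?rot12_mul1 ?rot12_mul_ge2 // !mxE /= ?p0 ?p01 ?q0 ?q01 /=; field.
have odd0 : \sum_(k < n.+1) band R n.+1 K k * (cos (k%:R * t) * sin (k%:R * t)) = 0.
  set S := (X in X = 0).
  (* reindexing by k -> - k changes the sign of the sum *)
  suff : S = - S by lra.
  rewrite {1}/S (reindex_inj oppr_inj) -sumrN; apply: eq_bigr => k _.
  have [-> |k0] := eqVneq k 0; first by rewrite oppr0 mul0r sin0 !mulr0 oppr0.
  have kn : (0 < k < n.+1)%N by rewrite ltn_ord andbT lt0n.
  have -> : ((- k)%R : nat) = (n.+1 - k)%N by rewrite /= modn_small //; lia.
  have kt : (n.+1 - k)%N%:R * t = - (k%:R * t) + 2 * pi.
    by rewrite natrB 1?ltnW // mulrBl muln_angle addrC.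
  rewrite band_sym //; last by lia.
  by rewrite kt cos_add2pi sin_add2pi cosN sinN !mulrN.
have cosD2 k : cos ((i + k)%R%:R * t) =
    cos (i%:R * t) * cos (k%:R * t) - sin (i%:R * t) * sin (k%:R * t).
  by rewrite (periodic_modn _ _ (@cos_add2pi R)) natrD (mulrDl _ _ t) cosD.
have {}odd0 : sin (i%:R * t) * J p q * \sum_(k < n.+1) band R n.+1 K k *
    (cos (k%:R * t) * sin (k%:R * t)) = 0 by rewrite odd0 mulr0.
rewrite !ffunE mxE [in RHS]mxE -[RHS]subr0 -[X in _ = _ - X]odd0.
rewrite /lambda /band_transform /cos_transform [2^-1 * _]mulrDr !mulr_sumr.
rewrite -big_split -sumrB /= mulr_suml -sumrB.
apply: eq_bigr => k _; rewrite !ffunE -scalerBl actJ cosD2.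
set x := k%:R * t; rewrite !mul1r mul0r cos0.
have -> : 2%:R * x = x + x by rewrite mulr_natl mulr2n.
rewrite cosD; set c := cos x; have -> : sin x * sin x = 1 - c ^+ 2 by rewrite -sin2cos2.
by field.
Qed.

Lemma band_supportsE :
  supports_one_twists d.+2 gamma <-> C 0 + C 2 <= 2 * C 1.
Proof.
rewrite supports_one_twistsE; last exact: one_twist_generator_rot12.
split=> [st|]; last exact: band_stable.
by rewrite leNgt; apply/negP => /band_unstable; apply.
Qed.
End BandStability.

(** * The critical value of alpha *)

Lemma or_indicator (R : realType) (b c : bool) : ~~ (b && c) ->
  (if b || c then 1 else 0) = b%:R + c%:R :> R.
Proof. by case: b c => -[] //= _; rewrite ?addr0 ?add0r. Qed.

Lemma GammaE (R : realType) (alpha : R) (n K : nat) (i j : 'I_n.+1) :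
  Num.floor (alpha * n.+1%:R) = K%:Z -> (2 * K <= n.+1)%N ->
  Gamma alpha n.+1 i j = band R n.+1 K (j - i)%R.
Proof.
move=> fK K2; rewrite !mxE fK ltz_nat /cyclic_dist /band.
have [->|ij] := eqVneq i j; first by rewrite subrr /= addr0.
have ijn : nat_of_ord i <> j by move=> /val_inj /eqP; apply/negP.
have [ilt jlt] := (ltn_ord i, ltn_ord j).
rewrite /= modnDmr.
case: (ltngtP i j) => // lt.
  have -> : ((j + (n.+1 - i)) %% n.+1 = j - i)%N.
    by rewrite addnBA 1?ltnW // addnC -addnBA 1?ltnW // modnDl modn_small //; lia.
  rewrite (distnEr (ltnW lt)).
  have -> : (minn (j - i) (n.+1 - (j - i)) < K)%N =
    (0 < j - i < K)%N || (n.+1 - K < j - i < n.+1)%N by lia.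
  by apply: or_indicator; lia.
have -> : ((j + (n.+1 - i)) %% n.+1 = n.+1 - (i - j))%N by rewrite modn_small; lia.
rewrite (distnEl (ltnW lt)).
have -> : (minn (i - j) (n.+1 - (i - j)) < K)%N =
    (0 < n.+1 - (i - j) < K)%N ||
    (n.+1 - K < n.+1 - (i - j) < n.+1)%N by lia.
by apply: or_indicator; lia.
Qed.

(** For large n, stability is decided by a number close to the gap: the critical
combination C 0 + C 2 - 2 C 1 times the positive factor sin y cos y. *)
Lemma Gamma_supports_near (R : realType) (d : nat) (alpha e : R) :
  0 < alpha -> alpha <= 1 / 2 -> 0 < e ->
  exists nstar : nat, forall n : nat, (nstar < n)%N ->
    exists2 x : R, `|x - twist_gap (2 * pi * alpha)| < e
                 & supports_one_twists d.+2 (Gamma alpha n) <-> x <= 0.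
Proof.
move=> a0 a2 e0.
have n1 : 0 <= alpha^-1 by rewrite invr_ge0 ltW.
have n2 : 0 <= 64 / e by rewrite divr_ge0 // ltW.
(* y <= 4 / n, so n > 64 / e gives 16 y < e; n > 1 / alpha gives an edge. *)
exists (3 + Num.bound alpha^-1 + Num.bound (64 / e))%N => -[//|n] nn.
have p0 := @pi_gt0 R; have p4 : pi <= 4 :> R by have := @pihalf_lt2 R; lra.
have n3 : (3 < n.+1)%N by lia.
have N0 : 0 < n.+1%:R :> R by rewrite ltr0n.
have B1 : alpha^-1 < n.+1%:R.
  by apply: lt_le_trans (archi_boundP n1) _; rewrite ler_nat; lia.
have B2 : 64 / e < n.+1%:R.
  by apply: lt_le_trans (archi_boundP n2) _; rewrite ler_nat; lia.
have an1 : 1 < alpha * n.+1%:R by rewrite mulrC -ltr_pdivrMr // mul1r.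
have := floor_ge0 (alpha * n.+1%:R); rewrite (le_trans ler01 (ltW an1)).
case fE : (Num.floor _) => [K|//] _.
have Kl : K%:R <= alpha * n.+1%:R :> R by have := floor_le (alpha * n.+1%:R); rewrite fE.
have Ku : alpha * n.+1%:R < K%:R + 1 :> R.
  by have := floorD1_gt (alpha * n.+1%:R); rewrite fE intrD.
have K0 : (0 < K)%N by rewrite -(ltr0n R); lra.
have K2 : (2 * K <= n.+1)%N by rewrite -(ler_nat R) natrM; nra.
have gE i j := @GammaE R alpha n K i j fE K2.
pose y : R := pi / n.+1%:R.
have y0 : 0 < y by rewrite divr_gt0.
have ye : 16 * y < e.
  move: B2; rewrite ltr_pdivrMr // => B2.
  rewrite /y mulrA ltr_pdivrMr //; lra.
have y2 : y < pi / 2.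
  have N4 : 4 <= n.+1%:R :> R by rewrite ler_nat.
  by rewrite /y ltr_pdivrMr //; nra.
have scy : 0 < sin y * cos y.
  by rewrite mulr_gt0 // ?sin_gt0_pihalf ?cos_gt0_pihalf ?y0 //; apply/andP; split; lra.
have Kl' : alpha * n.+1%:R - 1 < K%:R by lra.
have near := critical_mode_gap n3 K0 a2 Kl' Kl (erefl y).
exists ((band_transform R n.+1 K 0 + band_transform R n.+1 K 2
  - 2 * band_transform R n.+1 K 1) * (sin y * cos y)); first exact: le_lt_trans near ye.
apply: iff_trans (band_supportsE d gE K0 K2) _.
by rewrite pmulr_lle0 // subr_le0.
Qed.

Theorem theorem2p20 (R : realType) (d : nat) (hd : (2 <= d)%N) :
  exists alphastar : R,
    [/\ 0 < alphastar,
        `|alphastar - (340 / 10 ^+ 3 + 461 / 10 ^+ 6)| < 5 / 10 ^+ 7,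
        forall alpha : R, 0 < alpha -> alpha < alphastar ->
          exists nstar : nat, forall n : nat, (nstar < n)%N ->
            supports_one_twists d (Gamma alpha n)
      & forall alpha : R, alphastar < alpha -> alpha <= 1 / 2 ->
          exists nstar : nat, forall n : nat, (nstar < n)%N ->
            ~ supports_one_twists d (Gamma alpha n)].
Proof.
case: d hd => [|[|d]] // _.
have [alphastar [al au gap0]] := critical_alpha R.
have p0 := @pi_gt0 R.
exists alphastar; split; first by lra.
- by rewrite ltr_norml; apply/andP; split; lra.
- move=> alpha a0 aa.
  have gap_lt0 : twist_gap (2 * pi * alpha) < 0.
    case: (leP (2 * pi * alpha) (pi / 2)) => a4.
      by apply: twist_gap_lt0_pihalf; rewrite ?mulr_gt0.
    by rewrite -gap0; apply: twist_gap_incr; nra.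
  have e0 : 0 < - twist_gap (2 * pi * alpha) by rewrite oppr_gt0.
  have a2 : alpha <= 1 / 2 by lra.
  have [nstar near] := Gamma_supports_near d a0 a2 e0.
  exists nstar => n /near[x]; rewrite ltr_norml => /andP[_ xg] ->; lra.
- move=> alpha aa a2.
  have gap_gt0 : 0 < twist_gap (2 * pi * alpha).
    by rewrite -gap0; apply: twist_gap_incr; nra.
  have a0 : 0 < alpha by lra.
  have [nstar near] := Gamma_supports_near d a0 a2 gap_gt0.
  exists nstar => n /near[x]; rewrite ltr_norml => /andP[xg _] ->; lra.
Qed.
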